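(* Let $w\in S_\infty$ and $i\ge1$. There is an involution $\tau_i:\mathcal P(w)\to\mathcal P(w)$ such that for every $D\in\mathcal P(w)$: (1) $\tau_i(D)$ coincides with $D$ in all rows with index different from $i$ and $i+1$; (2) $\mathrm{start}_i(\tau_i(D))=\mathrm{start}_i(D)$, and $\tau_i(D)$ coincides with $D$ in all columns with index strictly less than $\mathrm{start}_i(D)$; (3) $l^i_i(\tau_i(D))=l^i_{i+1}(D)$.
   Context: Permutations: $S_\infty=\bigcup_n S_n$ is generated by the simple transpositions $s_a=(a\ a{+}1)$, $a\ge 1$; $l(w)$ is the Coxeter length of $w$. A pipe dream is a finite subset $D\subset\mathbb{Z}_{>0}\times\mathbb{Z}_{>0}$; its elements $(r,c)$ are called crosses (in row $r$, column $c$). The reading word of $D$ is obtained by listing the crosses row by row from top to bottom, within each row from right to left (decreasing $c$), and recording for each cross $(r,c)$ its antidiagonal index $r+c-1$; this gives a word $(a_1,\dots,a_k)$. For $u\in S_\infty$ put $u\star s_a=us_a$ if $l(us_a)=l(u)+1$ and $u\star s_a=u$ otherwise. The Demazure product of $D$ is $\delta(D)=(\cdots((e\star s_{a_1})\star s_{a_2})\cdots)\star s_{a_k}$. For $w\in S_\infty$, $\mathcal P(w)=\{D:\delta(D)=w\}$. For a pipe dream $D$ and row index $i$, $\mathrm{start}_i(D)=\min\{c\ge1:(i,c)\notin D\}$, and for $r\in\{i,i+1\}$, $l^i_r(D)$ denotes the number of crosses $(r,c)\in D$ with $c\ge \mathrm{start}_i(D)$. *)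

(* Defs.v *)
From mathcomp Require Import all_boot.
Set Implicit Arguments. Unset Strict Implicit. Unset Printing Implicit Defensive.

(* Positions are the positive integers; 0 is always fixed. *)

Definition stransp (a : nat) (x : nat) : nat :=
  if x == a then a.+1 else if x == a.+1 then a else x.

Fixpoint word_prod (s : seq nat) : nat -> nat :=
  match s with
  | [::] => id
  | a :: s' => fun x => stransp a (word_prod s' x)
  end.

Definition good_word (s : seq nat) : bool := all (fun a => 0 < a) s.

Definition in_Sinf (w : nat -> nat) : Prop :=
  exists s, good_word s /\ word_prod s =1 w.

Definition coxlen (u : nat -> nat) (k : nat) : Prop :=
  (exists s, [/\ good_word s, size s = k & word_prod s =1 u]) /\
  (forall s, good_word s -> word_prod s =1 u -> k <= size s).

Definition star (u : nat -> nat) (a : nat) (v : nat -> nat) : Prop :=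
  exists k, coxlen u k /\
    ((coxlen (fun x => u (stransp a x)) k.+1 /\ v =1 (fun x => u (stransp a x)))
     \/ (~ coxlen (fun x => u (stransp a x)) k.+1 /\ v =1 u)).

Fixpoint demazure (u : nat -> nat) (s : seq nat) (v : nat -> nat) : Prop :=
  match s with
  | [::] => v =1 u
  | a :: s' => exists u', star u a u' /\ demazure u' s' v
  end.

(* A pipe dream (finite subset of Z>0 x Z>0) is represented canonically by the
   sequence of its crosses (r, c) listed in reading order: rows top to bottom,
   within a row right to left.  Strict sortedness makes the representation
   unique, so Leibniz equality is equality of sets. *)
Definition read_lt (p q : nat * nat) : bool :=
  (p.1 < q.1) || ((p.1 == q.1) && (q.2 < p.2)).

Definition pipe_dream (D : seq (nat * nat)) : bool :=
  all (fun p => (0 < p.1) && (0 < p.2)) D && sorted read_lt D.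

(* reading word: antidiagonal indices r + c - 1 in reading order *)
Definition reading_word (D : seq (nat * nat)) : seq nat :=
  map (fun p => p.1 + p.2 - 1) D.

Definition demazure_of (D : seq (nat * nat)) (w : nat -> nat) : Prop :=
  demazure id (reading_word D) w.

Definition inP (w : nat -> nat) (D : seq (nat * nat)) : Prop :=
  pipe_dream D /\ demazure_of D w.

Definition max_col (D : seq (nat * nat)) : nat := foldr (fun p m => maxn p.2 m) 0 D.

Lemma max_col_ge D p : p \in D -> p.2 <= max_col D.
Proof.
elim: D => [|q D IH] //=; rewrite inE => /orP [/eqP -> | H].
  by rewrite leq_maxl.
by apply: leq_trans (IH H) (leq_maxr _ _).
Qed.

Lemma start_exists (i : nat) (D : seq (nat * nat)) :
  exists c, (0 < c) && ((i, c) \notin D).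
Proof.
exists (max_col D).+1; apply/andP; split => //; apply/negP => H.
by have := max_col_ge H; rewrite /= ltnn.
Qed.

Definition start (i : nat) (D : seq (nat * nat)) : nat := ex_minn (start_exists i D).

Definition lcount (i r : nat) (D : seq (nat * nat)) : nat :=
  count (fun p => (p.1 == r) && (start i D <= p.2)) D.

(* Main.v *)
Require Import Defs.
From mathcomp Require Import all_boot all_algebra boolp.
From mathcomp Require Import zify ring.
Set Implicit Arguments. Unset Strict Implicit. Unset Printing Implicit Defensive.

(* Let [D] have row [i] full up to column [st - 1] and empty at column
   [st = start i D].  The crosses of rows [i] and [i.+1] in columns [>= st] have
   letters [>= i + st], which commute with the letters [< i + st - 1] of the full
   initial part of row [i].  So the two rows contribute, up to a fixed context, a
   product of two decreasing words [A] and [B] in the generators [>= i + st].  In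
   the 0-Hecke algebra let [P(x)] be the product of [1 + x T_a] over decreasing
   [a]; by Fomin and Kirillov the Yang--Baxter equation gives
   [P(x) P(y) = P(y) P(x)].  Comparing coefficients, the number of pairs [(A, B)]
   with given Demazure product and sizes [(p, q)] is symmetric in [p] and [q], and
   matching the two lists of pairs index by index yields the involution.  The
   letters are bounded in terms of [w], so these lists are finite. *)

(** * Sorting operators and their 0-Hecke relations *)

(* Right Demazure multiplication by [s_a]: it sorts the values at positions
   [a], [a.+1] into decreasing order (see [pi_opE]). *)
Definition pi_op (a : nat) (u : nat -> nat) : nat -> nat :=
  if u a < u a.+1 then u \o stransp a else u.

Definition act (u : nat -> nat) (s : seq nat) : nat -> nat :=
  foldl (fun v a => pi_op a v) u s.

Lemma pi_opE a u x : pi_op a u x =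
  if x == a then maxn (u a) (u a.+1)
  else if x == a.+1 then minn (u a) (u a.+1) else u x.
Proof.
by rewrite /pi_op; case: ifP => h; rewrite /= ?/stransp;
  (do !case: eqP => //=); intros; subst; lia.
Qed.

Lemma pi_op_idem a u : pi_op a (pi_op a u) = pi_op a u.
Proof. by apply/funext=> x; rewrite !pi_opE; do !case: eqP => //=; lia. Qed.

Lemma pi_op_comm a b u : a.+1 < b -> pi_op a (pi_op b u) = pi_op b (pi_op a u).
Proof.
move=> ab; apply/funext=> x; rewrite !pi_opE; do !case: eqP => //=; lia.
Qed.

(** Both sides sort the values at [a], [a.+1], [a.+2] into decreasing order. *)
Lemma pi_op_braid a u :
  pi_op a (pi_op a.+1 (pi_op a u)) = pi_op a.+1 (pi_op a (pi_op a.+1 u)).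
Proof.
apply/funext=> x; rewrite !pi_opE.
have E n : (n == n.+1) = false by lia.
have E' n : (n.+1 == n) = false by lia.
have E2 n : (n == n.+2) = false by lia.
have E2' n : (n.+2 == n) = false by lia.
rewrite !(eqxx, E, E', E2, E2') /=.
do !case: eqP => //=; lia.
Qed.

Lemma act_cat u s t : act u (s ++ t) = act (act u s) t.
Proof. exact: foldl_cat. Qed.

Lemma act_pi_comm u s a : all (fun b => a.+1 < b) s ->
  act (pi_op a u) s = pi_op a (act u s).
Proof.
by elim: s u => //= b s IH u /andP[ab /IH{}IH]; rewrite -pi_op_comm.
Qed.

Lemma act_comm u s t : allrel (fun a b => a.+1 < b) s t ->
  act u (s ++ t) = act u (t ++ s).
Proof.
rewrite !act_cat; elim: s u => //= a s IH u.
by rewrite allrel_consl => /andP[/act_pi_comm <- /IH ->].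
Qed.

(** * Coxeter length and the Demazure product *)

Lemma stranspK a : involutive (stransp a).
Proof. by move=> x; rewrite /stransp; do !case: eqP => //=; lia. Qed.

Lemma word_prod_inj s : injective (word_prod s).
Proof.
elim: s => [|a s IH] x y //= /(inv_inj (@stranspK a)); exact: IH.
Qed.

Lemma word_prod_rcons s a x : word_prod (rcons s a) x = word_prod s (stransp a x).
Proof. by elim: s => //= b s ->. Qed.

(* Peeling letters off the left, the first one whose removal restores
   [u a < u a.+1] is the one exchanged for [a]. *)
Lemma word_exchange s a : word_prod s a.+1 < word_prod s a ->
  exists s', [/\ good_word s -> good_word s', (size s').+1 = size s
    & word_prod s' =1 word_prod s \o stransp a].
Proof.
elim: s => [|b s IH] /=; first by rewrite ltnNge leqnSn.
set u := word_prod s in IH *; case: (ltngtP (u a.+1) (u a)) => [lt|lt|eq] h.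
- have [s' [gs ss es]] := IH lt; exists (b :: s').
  split=> [/=|/=|x /=]; last by rewrite es.
    by case/andP => -> /gs.
  by rewrite ss.
- have [ua ua1] : u a = b /\ u a.+1 = b.+1.
    by move: h; rewrite /stransp; do !case: eqP => //=; lia.
  exists s; split=> // [/andP[]//|x /=].
  rewrite -/u -ua {2}/stransp; case: eqP => [->|na].
    by rewrite ua1 /stransp ua; do !case: eqP => //=; lia.
  case: eqP => [->|na1]; first by rewrite /stransp eqxx ua ua1.
  have := (@word_prod_inj s x a); have := (@word_prod_inj s x a.+1).
  rewrite -/u ua1 ua /stransp => h1 h2.
  by case: eqP => [/h2//|_]; case: eqP => [/h1|].
- by have := @word_prod_inj s _ _ eq; lia.
Qed.

Lemma coxlen_ex s : good_word s -> exists k, coxlen (word_prod s) k.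
Proof.
move=> gs; pose P k := exists t, [/\ good_word t, size t = k & word_prod t =1 word_prod s].
have exP : exists k, `[< P k >] by exists (size s); apply/asboolP; exists s.
case: (ex_minnP exP) => k /asboolP kP kmin; exists k; split=> // t gt et.
by apply: kmin; apply/asboolP; exists t.
Qed.

Lemma coxlen_uniq u k k' : coxlen u k -> coxlen u k' -> k = k'.
Proof.
move=> [[s [gs <- es]] m] [[t [gt <- et]] m'].
by apply/eqP; rewrite eqn_leq m // m'.
Qed.

(** If [u] descends at [a], [word_exchange] gives [u \o stransp a] a word shorter than [k]; if it
    ascends, every word of [u \o stransp a] yields a word of [u] with one letter fewer. *)
Lemma coxlen_step u k a : 0 < a -> coxlen u k ->
  coxlen (fun x => u (stransp a x)) k.+1 <-> u a < u a.+1.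
Proof.
move=> a0 [[s [gs ss es]] m]; split=> [[_ m']|lt].
  rewrite ltnNge; apply/negP => le.
  have [|s' [gs' ss' es']] := @word_exchange s a.
    rewrite !es ltn_neqAle le andbT -!es; apply/eqP => /word_prod_inj; lia.
  by have := m' s' (gs' gs) (fun x => etrans (es' x) (es _)); lia.
split=> [|t gt et].
  exists (rcons s a); split=> [||x]; last by rewrite word_prod_rcons es.
    by rewrite /good_word all_rcons a0.
  by rewrite size_rcons ss.
have [|t' [gt' st' et']] := @word_exchange t a.
  by rewrite !et /stransp eqxx eqxx; case: eqP => //; lia.
rewrite -st'; apply: (m _ (gt' gt)) => x.
by rewrite et' /= et stranspK.
Qed.

Lemma starP u a v : in_Sinf u -> 0 < a -> star u a v <-> v = pi_op a u.
Proof.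
move=> [s [gs /funext <-]] a0; split=> [[k [lu]]|->].
  rewrite (coxlen_step a0 lu) /pi_op.
  by case=> -[h /funext ->]; [rewrite h|case: ifP].
have [k lu] := coxlen_ex gs; exists k; split=> //.
rewrite (coxlen_step a0 lu) /pi_op; case: ifP => h; first by left.
by right.
Qed.

Lemma pi_op_Sinf u a : in_Sinf u -> 0 < a -> in_Sinf (pi_op a u).
Proof.
move=> uS a0; rewrite /pi_op; case: ifP => // _; case: uS => s [gs es].
exists (rcons s a); split=> [|x]; last by rewrite word_prod_rcons es.
by rewrite /good_word all_rcons a0.
Qed.

Lemma demazureP u s v : in_Sinf u -> good_word s ->
  demazure u s v <-> v = act u s.
Proof.
elim: s u v => [|a s IH] u v uS /=; first by split=> [/funext|->].
case/andP=> a0 gs; split=> [[u' []]|].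
  by rewrite starP // => ->; rewrite IH //; apply: pi_op_Sinf.
move=> ->; exists (pi_op a u); rewrite starP //; split=> //.
by rewrite IH //; apply: pi_op_Sinf.
Qed.

Lemma in_Sinf_id : in_Sinf id.
Proof. by exists [::]. Qed.

Lemma inPE w D : inP w D <-> pipe_dream D /\ w = act id (reading_word D).
Proof.
split=> -[pD h]; split=> //; move: h; rewrite /demazure_of demazureP //;
  try exact: in_Sinf_id;
  case/andP: pD => pD _; rewrite /good_word all_map;
  apply: sub_all pD => -[r c] /=; lia.
Qed.

(** * Bounding the letters of a word by its Demazure product *)

(* [u] does not preserve the initial segment [0, ..., a]; this is how the use of
   the letter [a] remains visible in a Demazure product. *)
Definition crosses_cut (a : nat) (u : nat -> nat) : Prop :=
  exists x y, [/\ x <= a, a < y & u y < u x].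

Lemma crosses_cut_pi a b u : crosses_cut a u -> crosses_cut a (pi_op b u).
Proof.
move=> [x [y [xa ay lt]]]; case: (eqVneq a b) => [<-|ab].
  (* Sorting at the cut only raises the value at [a] and lowers the one at [a.+1]. *)
  exists x, y; split=> //; rewrite !pi_opE.
  do !case: eqP => //=; try lia; intros; subst; lia.
rewrite /pi_op; case: ifP => _; last by exists x, y.
(* As [b] differs from [a], [stransp b] preserves both sides of the cut. *)
exists (stransp b x), (stransp b y); rewrite /= !stranspK; split=> //.
  by rewrite /stransp; do !case: eqP => //=; lia.
by rewrite /stransp; do !case: eqP => //=; lia.
Qed.

Lemma pi_op_inj a u : injective u -> injective (pi_op a u).
Proof.
rewrite /pi_op; case: ifP => // _ ui x y /= /ui; exact: inv_inj (@stranspK a) _ _.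
Qed.

Lemma crosses_cut_act u s a : injective u -> a \in s -> crosses_cut a (act u s).
Proof.
have keep b v t : crosses_cut b v -> crosses_cut b (act v t).
  by elim: t v => //= c t IH v h; apply: IH; apply: crosses_cut_pi.
elim: s u => //= b s IH u ui; rewrite inE => /orP[/eqP ->|as_]; last first.
  by apply: IH => //; apply: pi_op_inj.
apply: keep; exists b, b.+1; split=> //; rewrite !pi_opE eqxx eqxx.
have -> : (b.+1 == b) = false by lia.
have : u b <> u b.+1 by move/ui; lia.
lia.
Qed.

Lemma Sinf_bound w : in_Sinf w -> exists N, forall x, N <= x -> w x = x.
Proof.
move=> [s [_ /funext <-]] {w}; elim: s => [|a s [N IH]]; first by exists 0.
exists (maxn N a.+2) => x /=; rewrite geq_max => /andP[/IH -> ax].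
by rewrite /stransp; do !case: eqP => //=; lia.
Qed.

(** Let [w] be the product. A letter [a >= N] would give [x <= a < y] with [w y < w x]. Then
    [w y = y >= N], so [w x] is fixed as well and injectivity forces [w x = x < y], a
    contradiction. *)
Lemma act_letter_bound s N :
  (forall x, N <= x -> act id s x = x) -> all (fun a => a < N) s.
Proof.
move=> fixN; apply/allP => a as_; rewrite ltnNge; apply/negP => Na.
have [|x [y [xa ay]]] := @crosses_cut_act id s a _ as_; first by [].
have wi : injective (act id s).
  have : injective (id : nat -> nat) by [].
  elim: s id {fixN as_} => //= b s IH u ui; apply: IH; exact: pi_op_inj.
rewrite (fixN y) => [lt|]; last by lia.
have : act id s (act id s x) = act id s x by apply: fixN; lia.
move/wi; lia.
Qed.

(** * Decreasing words in an interval of letters *)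

Fixpoint subs (m k : nat) : seq (seq nat) :=
  if k is k'.+1 then subs m.+1 k' ++ map (rcons^~ m) (subs m.+1 k')
  else [:: [::]].

Lemma mem_subs m k s :
  (s \in subs m k) = sorted gtn s && all (fun a => m <= a < m + k) s.
Proof.
have tr : transitive gtn by move=> x y z /= h1 h2; apply: ltn_trans h1.
elim: k m s => [|k IH] m s /=.
  rewrite inE; case: s => //= a s; rewrite addn0.
  by case: ltnP => //=; rewrite ?andbF.
have inj : injective (rcons^~ m) by move=> x y /rcons_inj[].
rewrite mem_cat IH.
case/lastP: s => [//|s a].
rewrite !(sorted_pairwise tr) pairwise_rcons !all_rcons addSnnS.
have [->|am] := eqVneq a m.
  rewrite (mem_map inj) IH ltnn /= andbF /= leqnn addSnnS (sorted_pairwise tr).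
  have -> : m < m + k.+1 by lia.
  rewrite /= [RHS]andbAC [RHS]andbC; congr (_ && _).
  rewrite -all_predI; apply: eq_all => b /=; lia.
have -> : (rcons s a \in [seq rcons i m | i <- subs m.+1 k]) = false.
  by apply/mapP => -[t _ /rcons_inj [_ /eqP]]; rewrite (negPf am).
rewrite orbF; apply/idP/idP => /and3P[/andP[h1 h2] h3 h4]; apply/and3P; split.
- by rewrite h1.
- by lia.
- by apply: sub_all h4 => b; lia.
- by rewrite h1.
- by lia.
- apply/allP => b bs; move/allP: h1 => /(_ _ bs) /=.
  by move/allP: h4 => /(_ _ bs); lia.
Qed.

Lemma subs_uniq m k : uniq (subs m k).
Proof.
elim: k m => //= k IH m.
rewrite cat_uniq IH map_inj_uniq ?IH ?andbT; last by move=> x y /rcons_inj[].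
apply/hasPn => s /mapP[t _ ->]; rewrite mem_subs all_rcons; lia.
Qed.

(** * Commutation of the Fomin-Kirillov products *)

Section Commutation.
Import GRing.Theory.
Local Open Scope ring_scope.
Variable R : idomainType.
Implicit Types (x y : R) (f g : (nat -> nat) -> R).

(* Right multiplication by [1 + x T_a], acting on functions of the permutation. *)
Definition hop (a : nat) x f (u : nat -> nat) : R := f u + x * f (pi_op a u).

Fixpoint Pop (m k : nat) x f : (nat -> nat) -> R :=
  if k is k'.+1 then Pop m.+1 k' x (hop m x f) else f.

(** Expansion of the product: [hop m] is innermost in [Pop], so [m] acts last on [u], matching its
    final place in the words of [subs]. *)
Lemma PopE m k x f u :
  Pop m k x f u = \sum_(s <- subs m k) x ^+ size s * f (act u s).
Proof.
elim: k m f => [|k IH] m f /=; first by rewrite big_seq1 expr0 mul1r.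
rewrite IH big_cat big_map /= -big_split /=; apply: eq_bigr => s _.
by rewrite size_rcons -cats1 act_cat /= exprS /hop; ring.
Qed.

Lemma PopZ m k x c f : Pop m k x (fun u => c * f u) = (fun u => c * Pop m k x f u).
Proof.
apply/funext => u; rewrite !PopE mulr_sumr; apply: eq_bigr => s _; ring.
Qed.

Lemma hopZ a x c f : hop a x (fun u => c * f u) = (fun u => c * hop a x f u).
Proof. by apply/funext => u; rewrite /hop; ring. Qed.

Lemma hop_Pop_comm a m k x y f : (a.+1 < m)%N ->
  hop a x (Pop m k y f) = Pop m k y (hop a x f).
Proof.
move=> am; apply/funext => u; rewrite /hop !PopE mulr_sumr -big_split /=.
apply: eq_big_seq => s; rewrite mem_subs => /andP[_ sm].
rewrite act_pi_comm; first by ring.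
by apply: sub_all sm => b; lia.
Qed.

(* The Yang--Baxter equation [h2(x-y) h1(x) h2(y) h1(y) = h1(y) h2(x) h1(x)],
   [x-y] being the formal difference [(x - y) / (1 + y)], cleared of its
   denominator: [h2(x-y)] is [h2(x)] times the inverse of [h2(y)]. *)
Lemma hop_yang_baxter a x y f :
  let g := hop a x (hop a.+1 y (hop a y f)) in
  hop a.+1 x (fun u => (1 + y) * g u - y * g (pi_op a.+1 u)) =
  (fun u => (1 + y) * hop a y (hop a.+1 x (hop a x f)) u).
Proof.
apply/funext => u; rewrite /hop !(pi_op_idem, pi_op_braid).
ring.
Qed.

(** Induction on [k]: [hop m] moves past the letters [>= m.+2], which leaves the [g] of
    [hop_yang_baxter] innermost. Since [(1 + y) g] is [hop m.+1 y kg], the induction hypothesis at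
    [m.+1] applies to [kg]; then Yang-Baxter rewrites [hop m.+1 x kg], and [1 + y] cancels in the
    domain [R]. *)
Lemma Pop_comm m k x y f : 1 + y != 0 ->
  Pop m k x (Pop m k y f) = Pop m k y (Pop m k x f).
Proof.
move=> y1; elim: k m f => [//|[|k] IH] m f.
  by apply/funext => u; rewrite /= /hop !pi_op_idem; ring.
have {}IH g := IH m.+1 g.
have C z t h := @hop_Pop_comm m m.+2 k z t h (ltnSn _).
rewrite /= in IH *; rewrite !C.
pose g := hop m x (hop m.+1 y (hop m y f)); rewrite -/g.
pose kg u := (1 + y) * g u - y * g (pi_op m.+1 u).
have Eg : (fun u => (1 + y) * g u) = hop m.+1 y kg.
  by apply/funext => u; rewrite /hop /kg pi_op_idem; ring.
have := IH kg; rewrite -Eg hop_yang_baxter !(PopZ, hopZ) => E.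
by apply/funext => u; apply: (mulfI y1); have := congr1 (@^~ u) E.
Qed.

End Commutation.

(** * Symmetry of the sizes by comparing coefficients *)

Section SizeSymmetry.
Import GRing.Theory.
Local Open Scope ring_scope.

Definition sub_pairs m k : seq (seq nat * seq nat) :=
  [seq (s, t) | s <- subs m k, t <- subs m k].

Definition pairs_to (u v : nat -> nat) m k :=
  [seq z <- sub_pairs m k | `[< act (act u z.1) z.2 = v >]].

Lemma pairs_to_symm u v m k p q :
  count (fun z => (size z.1 == p) && (size z.2 == q)) (pairs_to u v m k) =
  count (fun z => (size z.1 == q) && (size z.2 == p)) (pairs_to u v m k).
Proof.
(* The outer variable marks [size z.1], the inner one [size z.2]; over [int], distinct counts remain
   distinct coefficients. *)
pose x : {poly {poly int}} := 'X; pose y : {poly {poly int}} := 'X%:P.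
have y1 : 1 + y != 0.
  rewrite /y -polyC1 -polyCD polyC_eq0 addrC.
  by rewrite -(size_poly_eq0) -polyC1 size_XaddC.
(* With the indicator of [v], the double [Pop] at [u] is the generating function of
   [pairs_to u v m k]. *)
pose f (t : nat -> nat) : {poly {poly int}} := (`[< t = v >])%:R.
have PPE (a b : {poly {poly int}}) : Pop m k a (Pop m k b f) u =
    \sum_(z <- pairs_to u v m k) a ^+ size z.1 * b ^+ size z.2.
  rewrite PopE big_filter [RHS]big_mkcond big_allpairs_dep /=.
  apply: eq_bigr => s _; rewrite PopE mulr_sumr; apply: eq_bigr => t _.
  by rewrite /f; case: `[< _ >]; rewrite /= ?mulr1 ?mulr0 // mulr0.
have cntE (S : seq (seq nat * seq nat)) c d :
    (\sum_(z <- S) x ^+ size z.1 * y ^+ size z.2)`_c`_d =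
    (count (fun z => (size z.1 == c) && (size z.2 == d)) S)%:R :> int.
  rewrite coef_sum coef_sum -sum1_count natr_sum [RHS]big_mkcond /=.
  apply: eq_bigr => z _; rewrite /x /y -polyC_exp mulrC coefCM coefXn.
  rewrite (eq_sym c); case: eqP => _ /=; rewrite ?mulr1 ?mulr0 ?coef0 //.
  by rewrite coefXn eq_sym; case: eqP.
have E := congr1 (@^~ u) (Pop_comm m k x f y1); rewrite /= !PPE in E.
apply/eqP; rewrite -(@Num.Theory.eqr_nat int) -!cntE {1}E.
pose swap (z : seq nat * seq nat) := (z.2, z.1).
have -> : \sum_(z <- pairs_to u v m k) y ^+ size z.1 * x ^+ size z.2 =
    \sum_(z <- [seq swap z | z <- pairs_to u v m k])
       x ^+ size z.1 * y ^+ size z.2.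
  by rewrite big_map; apply: eq_bigr => z _; rewrite mulrC.
rewrite !cntE count_map; apply/eqP; congr (_%:R).
by apply: eq_count => z /=; rewrite andbC.
Qed.
End SizeSymmetry.

(** * Matching two classes of equal size by rank *)

Definition transpose_by (T : eqType) (f g : T -> nat) (S : seq T) (x : T) : T :=
  nth x [seq y <- S | (f y == g x) && (g y == f x)]
    (index x [seq y <- S | (f y == f x) && (g y == g x)]).

(** The classes of [(p, q)] and [(q, p)] have equal size, so the rank of [x] is valid in the other
    class and the default of [nth] is never reached. The rank is kept, so a second application
    returns to [x]. *)
Lemma transpose_byP (T : eqType) (f g : T -> nat) (S : seq T) (x : T) :
  uniq S -> x \in S ->
  (forall p q, count (fun y => (f y == p) && (g y == q)) S =
               count (fun y => (f y == q) && (g y == p)) S) ->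
  let y := transpose_by f g S x in
  [/\ y \in S, f y = g x, g y = f x & transpose_by f g S y = x].
Proof.
move=> uS xS symS /=; set y := transpose_by _ _ _ x.
pose F p q := [seq z <- S | (f z == p) && (g z == q)].
have xF : x \in F (f x) (g x) by rewrite mem_filter !eqxx.
have ltF : index x (F (f x) (g x)) < size (F (g x) (f x)).
  by rewrite size_filter symS -size_filter index_mem.
have yF : y \in F (g x) (f x) by apply: mem_nth.
have := yF; rewrite mem_filter => /andP[/andP[/eqP fy /eqP gy] yS].
split=> //; rewrite /transpose_by fy gy -/(F _ _) -/(F _ _).
have -> : index y (F (g x) (f x)) = index x (F (f x) (g x)).
  by apply: index_uniq => //; apply: filter_uniq.
by rewrite (set_nth_default x) ?nth_index // index_mem.
Qed.

(** * The start column *)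

Lemma start_gt0 i D : 0 < start i D.
Proof. by rewrite /start; case: ex_minnP => c /andP[]. Qed.

Lemma start_notin i D : (i, start i D) \notin D.
Proof. by rewrite /start; case: ex_minnP => c /andP[]. Qed.

Lemma lt_start_in i D c : 0 < c < start i D -> (i, c) \in D.
Proof.
rewrite /start; case: ex_minnP => d _ min /andP[c0]; apply: contraTT => cD.
by rewrite -leqNgt min // c0.
Qed.

Lemma start_unique i D st : 0 < st -> (i, st) \notin D ->
  (forall c, 0 < c < st -> (i, c) \in D) -> start i D = st.
Proof.
move=> st0 stD ltD; apply/eqP; rewrite eqn_leq; apply/andP; split.
  by rewrite leqNgt; apply/negP => lt; rewrite lt_start_in ?st0 in stD.
rewrite leqNgt; apply/negP => lt; have := start_notin i D.
by rewrite ltD // start_gt0.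
Qed.

(** * Reading order and the cutting of a pipe dream into blocks *)

Lemma read_lt_trans : transitive read_lt.
Proof. by move=> [a b] [c d] [e f]; rewrite /read_lt /=; lia. Qed.

Lemma read_lt_irr : irreflexive read_lt.
Proof. by move=> [a b]; rewrite /read_lt /=; lia. Qed.

Lemma gtn_trans : transitive gtn.
Proof. by move=> x y z /= h1 h2; apply: ltn_trans h1. Qed.

Section Blocks.
Variables (i st : nat).

(** These solve [r + c - 1 = a] for [c] in rows [i] and [i.+1]. *)
Definition top_cross a := (i, a.+1 - i).
Definition bot_cross a := (i.+1, a - i).

(* In reading order: the rows above [i]; the two parts of row [i]; the two
   parts of row [i.+1]; the rows below. *)
Definition block (j : nat) (p : nat * nat) : bool :=
  match j with
  | 0 => p.1 < i
  | 1 => (p.1 == i) && (st <= p.2)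
  | 2 => (p.1 == i) && (p.2 < st)
  | 3 => (p.1 == i.+1) && (st <= p.2)
  | 4 => (p.1 == i.+1) && (p.2 < st)
  | _ => i.+1 < p.1
  end.

Definition part j (D : seq (nat * nat)) := [seq p <- D | block j p].

Definition glue (D : seq (nat * nat)) (U L : seq (nat * nat)) :=
  part 0 D ++ U ++ part 2 D ++ L ++ part 4 D ++ part 5 D.

Lemma mem_glue D U L p : all (block 1) U -> all (block 3) L ->
  ~~ block 1 p -> ~~ block 3 p -> (p \in glue D U L) = (p \in D).
Proof.
move=> aU aL n1 n3; rewrite !mem_cat !mem_filter.
have -> : (p \in U) = false by apply/negP => /(allP aU); rewrite (negPf n1).
have -> : (p \in L) = false by apply/negP => /(allP aL); rewrite (negPf n3).
by move: n1 n3; case: (p \in D); rewrite /= ?andbF //; lia.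
Qed.

Lemma part_glue D U L j : all (block 1) U -> all (block 3) L ->
  part j (glue D U L) = nth (part j D) [:: part 0 D; U; part 2 D; L] j.
Proof.
move=> aU aL.
(* All indices from 5 on name the same last block, hence [minn]. *)
have z k l (S : seq (nat * nat)) : all (block l) S ->
    minn k 5 != minn l 5 -> part k S = [::].
  move=> aS kl; apply/eqP; rewrite -(negbK (_ == _)) -has_filter.
  apply/hasPn => p /(allP aS).
  by move: k l kl {aS} => [|[|[|[|[|k]]]]] [|[|[|[|[|l]]]]] //=; lia.
have id_ k S : all (block k) S -> part k S = S by move/all_filterP.
have aP k : all (block k) (part k D) by apply: filter_all.
have i_ k : part k (part k D) = part k D by apply: id_.
rewrite /glue /part !filter_cat -!/(part _ _).
by case: j => [|[|[|[|[|j]]]]] /=;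
  rewrite ?(id_ _ _ aU) ?(id_ _ _ aL) ?i_ ?(z _ _ _ aU) ?(z _ _ _ aL)
    ?(z _ _ _ (aP 0)) ?(z _ _ _ (aP 2)) ?(z _ _ _ (aP 4)) ?(z _ _ _ (aP 5))
    //= ?cats0.
Qed.

Lemma pipe_dream_glue D U L : pipe_dream D ->
  all (block 1) U -> all (block 3) L ->
  pipe_dream U -> pipe_dream L -> pipe_dream (glue D U L).
Proof.
move=> /andP[pD sD] aU aL /andP[pU sU] /andP[pL sL].
have pp j : all (fun p => (0 < p.1) && (0 < p.2)) (part j D).
  by apply/allP => p; rewrite mem_filter => /andP[_ /(allP pD)].
rewrite /pipe_dream /glue !all_cat !pp pU pL /=.
have sp j : pairwise read_lt (part j D).
  by rewrite -(sorted_pairwise read_lt_trans) sorted_filter //; exact: read_lt_trans.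
have aP k : all (block k) (part k D) by apply: filter_all.
have rel k l X Y : k < l <= 5 -> all (block k) X -> all (block l) Y ->
    allrel read_lt X Y.
  move=> kl aX aY; apply/allrelP => p q /(allP aX) + /(allP aY).
  rewrite /read_lt; move: k l kl {aX aY} => [|[|[|[|[|k]]]]] [|[|[|[|[|l]]]]] //=; lia.
rewrite !(sorted_pairwise read_lt_trans) in sU sL *.
rewrite !pairwise_cat !allrel_catr !sp sU sL /= ?andbT.
by repeat (apply/andP; split); (apply: rel; last first; [try exact: aP; eassumption|try exact: aP; eassumption|]).
Qed.

Lemma glueK D : pipe_dream D -> glue D (part 1 D) (part 3 D) = D.
Proof.
move=> pD; have aP k : all (block k) (part k D) by apply: filter_all.
have pp j : pipe_dream (part j D).
  case/andP: pD => pD sD; apply/andP; split.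
    by apply/allP => p; rewrite mem_filter => /andP[_ /(allP pD)].
  by rewrite sorted_filter //; exact: read_lt_trans.
have /andP[_ sG] := pipe_dream_glue pD (aP 1) (aP 3) (pp 1) (pp 3).
apply: (irr_sorted_eq read_lt_trans read_lt_irr) => //; first by case/andP: pD.
move=> p; rewrite !mem_cat !mem_filter.
by case: (p \in D); rewrite ?andbF //=; lia.
Qed.

(** Letters of block 2 are at most [i + st - 2] and those of [L] at least [i + st], so block 2 moves
    right past [L] and leaves [U] and [L] adjacent. *)
Lemma act_glue u D U L : all (block 1) U -> all (block 3) L -> 0 < i ->
  act u (reading_word (glue D U L)) =
  act (act (act (act u (reading_word (part 0 D))) (reading_word U)) (reading_word L))
    (reading_word (part 2 D ++ part 4 D ++ part 5 D)).
Proof.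
move=> aU aL i0; rewrite /reading_word !map_cat -!/(reading_word _) !act_cat.
congr (act (act _ _) _); move: (act (act u _) _) => v.
rewrite -!(act_cat v); apply: act_comm.
apply/allrelP => a b /mapP[p + ->] /mapP[q + ->].
rewrite mem_filter => /andP[+ _] /(allP aL); rewrite /=.
lia.
Qed.

(** As [(i, st)] is not a cross, row [i] starts at column [st.+1], and both rows get the same least
    letter [i + st]. The bound [N] also serves as a generous length for the interval. *)
Lemma reading_word_subs N D j : 0 < i -> pipe_dream D -> (i, st) \notin D ->
  all (fun a => a < N) (reading_word D) -> (j == 1) || (j == 3) ->
  reading_word (part j D) \in subs (i + st) N.
Proof.
move=> i0 /andP[pD sD] stD aN j13; rewrite mem_subs; apply/andP; split.
  have : sorted read_lt (part j D) by rewrite sorted_filter //; exact: read_lt_trans.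
  rewrite sorted_map; apply: (sub_in_sorted _ (filter_all (block j) D)) => -[r c] [r' c'].
  rewrite -!topredE /= /read_lt.
  by case/orP: j13 => /eqP -> /=; lia.
apply/allP => a /mapP[[r c]]; rewrite mem_filter => /andP[bp pD_] ->.
have /= := allP aN _ (map_f _ pD_).
suff : i + st <= r + c - 1 by lia.
case/orP: j13 bp => /eqP -> /= /andP[/eqP rE]; last by lia.
suff : c <> st by lia.
by move=> cE; rewrite -rE -cE pD_ in stD.
Qed.

Lemma top_crossP N s : s \in subs (i + st) N -> 0 < i -> 0 < st ->
  let U := map top_cross s in
  [/\ all (block 1) U, pipe_dream U, reading_word U = s & (i, st) \notin U].
Proof.
rewrite mem_subs => /andP[ss sb] i0 st0 /=; split.
- by rewrite all_map; apply: sub_all sb => a /=; lia.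
- apply/andP; split; first by rewrite all_map; apply: sub_all sb => a /=; lia.
  rewrite sorted_map; apply: (sub_in_sorted _ sb ss) => a b.
  by rewrite -!topredE /= /read_lt /=; lia.
- rewrite /reading_word -map_comp -[RHS]map_id; apply/eq_in_map => a /(allP sb) /=.
  by lia.
(* The cross [(i, st)] would have letter [i + st - 1], just below the interval. *)
- by apply/negP => /mapP[a /(allP sb) + []]; lia.
Qed.

Lemma bot_crossP N s : s \in subs (i + st) N -> 0 < i -> 0 < st ->
  let L := map bot_cross s in
  [/\ all (block 3) L, pipe_dream L & reading_word L = s].
Proof.
rewrite mem_subs => /andP[ss sb] i0 st0 /=; split.
- by rewrite all_map; apply: sub_all sb => a /=; lia.
- apply/andP; split; first by rewrite all_map; apply: sub_all sb => a /=; lia.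
  rewrite sorted_map; apply: (sub_in_sorted _ sb ss) => a b.
  by rewrite -!topredE /= /read_lt /=; lia.
- rewrite /reading_word -map_comp -[RHS]map_id; apply/eq_in_map => a /(allP sb) /=.
  by lia.
Qed.

Lemma top_cross_reading U : 0 < i -> all (block 1) U ->
  map top_cross (reading_word U) = U.
Proof.
move=> i0 /allP aU; rewrite -map_comp -[RHS]map_id; apply/eq_in_map => -[r c] /aU.
by case/andP => /= /eqP -> _; rewrite /top_cross /=; congr (_, _); lia.
Qed.

Lemma bot_cross_reading L : 0 < i -> all (block 3) L ->
  map bot_cross (reading_word L) = L.
Proof.
move=> i0 /allP aL; rewrite -map_comp -[RHS]map_id; apply/eq_in_map => -[r c] /aL.
by case/andP => /= /eqP -> _; rewrite /bot_cross /=; congr (_, _); lia.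
Qed.

End Blocks.

Lemma start_glue i D U L : all (block i (start i D) 1) U ->
  all (block i (start i D) 3) L -> (i, start i D) \notin U ->
  start i (glue i (start i D) D U L) = start i D.
Proof.
move=> aU aL stU; apply: start_unique (start_gt0 i D) _ _ => [|c clt].
  rewrite !mem_cat !mem_filter (negPf stU) (negPf (start_notin i D)) !andbF !orbF.
  by apply/negP => /(allP aL) /=; rewrite ltn_eqF.
case/andP: (clt) => _ ltc; rewrite mem_glue ?lt_start_in //=.
  by rewrite eqxx -ltnNge.
by rewrite ltn_eqF.
Qed.

(** * The involution *)

Definition row_letters i j D := reading_word (part i (start i D) j D).

Definition swapped_letters i N D : seq nat * seq nat :=
  let u := act id (row_letters i 0 D) in
  let A := row_letters i 1 D in
  let B := row_letters i 3 D in
  transpose_by (fun z => size z.1) (fun z => size z.2)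
    (pairs_to u (act (act u A) B) (i + start i D) N) (A, B).

Definition tau i N D :=
  let z := swapped_letters i N D in
  glue i (start i D) D (map (top_cross i) z.1) (map (bot_cross i) z.2).

Lemma sub_pairs_uniq m k : uniq (sub_pairs m k).
Proof.
by apply: allpairs_uniq; rewrite ?subs_uniq // => -[a b] [c d] _ _ [-> ->].
Qed.

Theorem theorem3p1 (w : nat -> nat) (i : nat) :
  in_Sinf w -> 1 <= i ->
  exists tau : seq (nat * nat) -> seq (nat * nat),
    forall D, inP w D ->
      [/\ inP w (tau D),
          tau (tau D) = D,
          (forall r c, r != i -> r != i.+1 -> ((r, c) \in tau D) = ((r, c) \in D)),
          start i (tau D) = start i D /\
            (forall r c, c < start i D -> ((r, c) \in tau D) = ((r, c) \in D))
        & lcount i i (tau D) = lcount i i.+1 D].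
Proof.
move=> /Sinf_bound[N wN] i0; exists (tau i N) => D /inPE[pD wD].
(* [N] comes from [w] alone, so it serves all of its pipe dreams. *)
have aN : all (fun a => a < N) (reading_word D).
  by apply: act_letter_bound => x; rewrite -wD; apply: wN.
set st := start i D.
have st0 : 0 < st := start_gt0 i D.
pose u := act id (row_letters i 0 D).
pose A := row_letters i 1 D; pose B := row_letters i 3 D.
pose v := act (act u A) B.
pose S := pairs_to u v (i + st) N.
have AS : A \in subs (i + st) N by apply: reading_word_subs => //; exact: start_notin.
have BS : B \in subs (i + st) N by apply: reading_word_subs => //; exact: start_notin.
have uS : uniq S by apply: filter_uniq; apply: sub_pairs_uniq.
have zS : (A, B) \in S.
  by rewrite mem_filter; apply/andP; split; [apply/asboolP|apply: allpairs_f].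
have [] := transpose_byP uS zS (pairs_to_symm u v (i + st) N).
rewrite -/(swapped_letters i N D); case Ez: (swapped_letters i N D) => [A' B'] /=.
move=> zS' sA sB zK.
move: zS'; rewrite mem_filter => /andP[/asboolP /= actz /allpairsP[[a b] /= [A'S B'S [??]]]].
subst a b.
have [aU pU rU stU] := top_crossP A'S i0 st0.
have [aL pL rL] := bot_crossP B'S i0 st0.
pose E := glue i st D (map (top_cross i) A') (map (bot_cross i) B').
have tD : tau i N D = E by rewrite /tau Ez.
rewrite tD.
have pE : pipe_dream E by apply: pipe_dream_glue.
have memE p : ~~ block i st 1 p -> ~~ block i st 3 p -> (p \in E) = (p \in D).
  exact: mem_glue.
have stE : start i E = st by apply: start_glue.
have aP k : all (block i st k) (part i st k D) by apply: filter_all.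
split.
(* The other blocks are unchanged, and [(A', B')] takes [u] to the same [v] as [(A, B)]. *)
- apply/inPE; split=> //; rewrite wD -{1}(glueK i st pD) !act_glue //.
  by rewrite rU rL; congr act; exact: esym actz.
(* [E] has the same start, [u] and [v], so its list of pairs is again [S] and [zK] restores
   [(A, B)]. *)
- rewrite /tau /swapped_letters /row_letters stE !part_glue //= rU rL.
  rewrite -/u actz -/S zK /glue !part_glue //=.
  rewrite /A /B /row_letters -/st.
  by rewrite (top_cross_reading i0 (aP 1)) (bot_cross_reading i0 (aP 3)) -[RHS](glueK i st pD).
- by move=> r c ri ri1; apply: memE; rewrite /= ?(negPf ri) ?(negPf ri1).
- by split=> // r c clt; apply: memE; rewrite /= leqNgt clt andbF.
- rewrite /lcount stE -/st -!size_filter.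
  have -> : [seq x <- E | (x.1 == i) && (st <= x.2)] = map (top_cross i) A'.
    exact: (@part_glue i st D _ _ 1 aU aL).
  by rewrite size_map sA size_map.
Qed.
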